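(* Let $(G,H)=(\mathrm O(p,q),\mathrm O(p_1,q_1)\times\mathrm O(p-p_1,q-q_1))$ with $0<p_1<p$, $0<q_1<q$, and let $\mathcal O(r_U,r_W,a,b_U,b_W)$ and $\mathcal O(r_U',r_W',a',b_U',b_W')$ be two $H$-orbits of isotropic subspaces of $V$ (of possibly different dimensions). There exist $S\in\mathcal O(r_U,r_W,a,b_U,b_W)$ and $S'\in\mathcal O(r_U',r_W',a',b_U',b_W')$ such that $S\supseteq S'$ if and only if the following inequalities hold: $$r_U\ge r_U',\quad r_W\ge r_W',\quad b_U\ge b_U',\quad b_W\ge b_W',$$ $$r_U+a+b_U\ge r_U'+a'+b_U',\qquad r_U+a+b_W\ge r_U'+a'+b_W',$$ $$r_W+a+b_U\ge r_W'+a'+b_U',\qquad r_W+a+b_W\ge r_W'+a'+b_W'.$$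
   Context: $V=\mathbb R^{p+q}$ has a nondegenerate symmetric bilinear form $B$ of signature $(p,q)$; $V=U\oplus W$ with $U\perp W$, $B|_U$ of signature $(p_1,q_1)$ and $B|_W$ of signature $(p-p_1,q-q_1)$. $G=\mathrm O(p,q)$ is the isometry group of $V$ and $H\simeq\mathrm O(p_1,q_1)\times\mathrm O(p-p_1,q-q_1)$ is the product of the isometry groups of $U$ and $W$. A subspace $S$ is isotropic if $S\perp S$. For a subspace $X$, $\mathrm{Rad}(X)=X\cap X^\perp$; $\mathbf P_US=(S+W)\cap U$, $\mathbf P_WS=(S+U)\cap W$. For isotropic $S$: $r_U(S)=\dim(S\cap U)$, $r_W(S)=\dim(S\cap W)$, $a(S)=\dim\frac{\mathrm{Rad}(\mathbf P_US)}{S\cap U}=\dim\frac{\mathrm{Rad}(\mathbf P_WS)}{S\cap W}$, and $b_U(S)$ (resp. $b_W(S)$) is the dimension of a maximal positive definite (resp. negative definite) subspace of $\mathbf P_US$. The 5-tuple $(r_U(S),r_W(S),a(S),b_U(S),b_W(S))$ determines the $H$-orbit of $S$ (and has sum $\dim S$); $\mathcal O(r_U,r_W,a,b_U,b_W)$ denotes the $H$-orbit with this 5-tuple. *)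

(* Defs.v *)
From HB Require Import structures.
From mathcomp Require Import all_boot all_order all_algebra.
From mathcomp Require Import sesquilinear classical_sets reals.

Set Implicit Arguments.
Unset Strict Implicit.
Unset Printing Implicit Defensive.

Import Order.TTheory GRing.Theory Num.Theory.

Local Open Scope ring_scope.

(* [X^⊥] with respect to [B] is MathComp's [orthov B X]. *)

Definition radical (R : realType) (V : vectType R) (B : {symmetric V})
    (X : {vspace V}) : {vspace V} :=
  (X :&: orthov B X)%VS.

Definition isotropic (R : realType) (V : vectType R) (B : {symmetric V})
    (S : {vspace V}) : Prop :=
  (S <= orthov B S)%VS.

Definition posdef (R : realType) (V : vectType R) (B : {symmetric V})
    (Y : {vspace V}) : Prop :=
  forall y, y \in Y -> y != 0 -> 0 < B y y.

Definition negdef (R : realType) (V : vectType R) (B : {symmetric V})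
    (Y : {vspace V}) : Prop :=
  forall y, y \in Y -> y != 0 -> B y y < 0.

Definition maximal_subspace (R : realType) (V : vectType R)
    (P : {vspace V} -> Prop) (X Y : {vspace V}) : Prop :=
  [/\ (Y <= X)%VS, P Y &
      forall Z : {vspace V}, (Z <= X)%VS -> P Z -> (Y <= Z)%VS -> Z = Y].

(* By Sylvester's law of inertia, all maximal positive (resp. negative)
   definite subspaces of X have the same dimension, so at most one n satisfies
   each of the next two predicates, also when B is degenerate on X. *)
Definition pos_index (R : realType) (V : vectType R) (B : {symmetric V})
    (X : {vspace V}) (n : nat) : Prop :=
  exists2 Y, maximal_subspace (posdef B) X Y & \dim Y = n.

Definition neg_index (R : realType) (V : vectType R) (B : {symmetric V})
    (X : {vspace V}) (n : nat) : Prop :=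
  exists2 Y, maximal_subspace (negdef B) X Y & \dim Y = n.

Definition has_signature (R : realType) (V : vectType R) (B : {symmetric V})
    (X : {vspace V}) (m n : nat) : Prop :=
  pos_index B X m /\ neg_index B X n.

(* The isometry group of (X, B|_X), through the endomorphisms of the ambient
   space that restrict to one of its elements. *)
Definition isometry_group (R : realType) (V : vectType R) (B : {symmetric V})
    (X : {vspace V}) : set 'End(V) :=
  [set g | (g @: X)%VS = X /\ {in X &, forall x y, B (g x) (g y) = B x y}].

(* For V = U ⊕ W an endomorphism is determined by its restrictions to U and W,
   so these are exactly the g_U ⊕ g_W with g_U in O(U) and g_W in O(W). *)
Definition isometry_group_prod (R : realType) (V : vectType R)
    (B : {symmetric V}) (U W : {vspace V}) : set 'End(V) :=
  (isometry_group B U `&` isometry_group B W)%classic.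

Lemma isometry_group_prod_sub (R : realType) (V : vectType R)
    (B : {symmetric V}) (U W : {vspace V}) :
  (U + W)%VS = fullv -> (U <= orthov B W)%VS ->
  (isometry_group_prod B U W `<=` isometry_group B fullv)%classic.
Proof.
move=> UW /orthovP oUW g [[gU BU] [gW BW]]; split.
  by rewrite -UW limgD gU gW.
have oWU w u : w \in W -> u \in U -> B w u = 0.
  by move=> wW uU; apply/eqP; rewrite herm_eq0C oUW.
have gUP u : u \in U -> g u \in U by move=> uU; rewrite -gU memv_img.
have gWP w : w \in W -> g w \in W by move=> wW; rewrite -gW memv_img.
move=> x y; rewrite -UW => /memv_addP[u uU [w wW ->]] /memv_addP[u' u'U [w' w'W ->]].
rewrite !(linearD g) !linearDl !linearDr /=.
rewrite (BU u u') // (BW w w') // (oUW u w') // (oWU w u') //.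
by rewrite (oUW (g u)) ?(oWU (g w)) ?gUP ?gWP.
Qed.

Definition orbit_of (R : realType) (V : vectType R) (B : {symmetric V})
    (U W S : {vspace V}) : set {vspace V} :=
  [set (g @: S)%VS | g in isometry_group_prod B U W]%classic.

(* P_U S is [proj_sub U W S], and P_W S is [proj_sub W U S]. *)
Definition proj_sub (R : realType) (V : vectType R)
    (U W S : {vspace V}) : {vspace V} :=
  ((S + W) :&: U)%VS.

(* The dimension of Rad(P_U S) / (S ∩ U): the subtraction does not truncate
   for isotropic S, see [capv_sub_radical_proj]. *)
Definition inv_a (R : realType) (V : vectType R) (B : {symmetric V})
    (U W S : {vspace V}) : nat :=
  (\dim (radical B (proj_sub U W S)) - \dim (S :&: U))%N.

Lemma capv_sub_radical_proj (R : realType) (V : vectType R)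
    (B : {symmetric V}) (U W S : {vspace V}) :
  (U <= orthov B W)%VS -> isotropic B S ->
  (S :&: U <= radical B (proj_sub U W S))%VS.
Proof.
move=> oUW isoS; rewrite subv_cap; apply/andP; split.
  by rewrite subv_cap capvSr (subv_trans (capvSl _ _)) ?addvSl.
apply: (@subv_trans _ _ (orthov B (S + W))).
  by rewrite orthovD (subv_trans (capvSl _ _)) // (subv_trans (capvSr _ _)).
by rewrite orthov_sym (subv_trans (capvSl _ _)) // orthov_sym.
Qed.

Definition has_invariants (R : realType) (V : vectType R) (B : {symmetric V})
    (U W S : {vspace V}) (rU rW a bU bW : nat) : Prop :=
  [/\ rU = \dim (S :&: U), rW = \dim (S :&: W), a = inv_a B U W S,
      pos_index B (proj_sub U W S) bU & neg_index B (proj_sub U W S) bW].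

(* O is the orbit O(r_U, r_W, a, b_U, b_W) of isotropic subspaces. *)
Definition is_isotropic_orbit (R : realType) (V : vectType R)
    (B : {symmetric V}) (U W : {vspace V}) (rU rW a bU bW : nat)
    (O : set {vspace V}) : Prop :=
  exists S, [/\ isotropic B S, has_invariants B U W S rU rW a bU bW
              & O = orbit_of B U W S].

(* Main.v *)
(* An isotropic S is the graph of an anti-isometry between P_U S / (S ∩ U) and
   P_W S / (S ∩ W), so it has a basis A ++ C ++ E ++ P ++ N with A a basis of
   S ∩ U, C a basis of S ∩ W, whose projection to U kills C and sends A ++ E, P, N
   to null, unit and anti-unit pairwise orthogonal vectors; the projection to W
   does the same with A and C exchanged and the opposite sign.  The five sizes
   are the invariants of S.

   If S' is contained in S, the inequalities hold because a semidefinite subspace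
   of a projection of S' meets a definite subspace of the opposite sign trivially.

   Conversely they amount to
     a' <= a + min(rU - rU', rW - rW') + min(bU - bU', bW - bW'),
   and inside S one can raise a by one either by trading a vector x of A and a
   vector y of C for x + y, or by trading x in P and y in N for x + y.  This gives
   a subspace of S with the invariants of S', and Witt's extension theorem,
   applied in U and in W, moves S' onto it. *)
Require Import Defs.
From mathcomp Require Import all_boot all_order all_algebra.
From mathcomp Require Import sesquilinear classical_sets reals boolp.
From mathcomp Require Import zify ring lra.

Set Implicit Arguments.
Unset Strict Implicit.
Unset Printing Implicit Defensive.

Import Order.TTheory GRing.Theory Num.Theory.

Local Open Scope ring_scope.

(** * Lists and zipped lists *)

Section Sequences.
Variables T T' : eqType.
Implicit Types (s t u : seq T).

Lemma perm_cat_tail s t u : perm_eq (s ++ t ++ u) (s ++ u ++ t).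
Proof. by rewrite perm_cat2l (permEl (perm_catC t u)). Qed.

Lemma uniq_map_inj (f : T -> T') s : uniq (map f s) -> {in s &, injective f}.
Proof.
elim: s => //= a s IH /andP[fa /IH inj] x y; rewrite !inE.
move=> /predU1P[->|xs] /predU1P[->|ys] // fxy; last exact: inj.
- by rewrite fxy map_f in fa.
- by rewrite -fxy map_f in fa.
Qed.

Lemma mem_zip s (t : seq T') z : z \in zip s t -> z.1 \in s /\ z.2 \in t.
Proof.
elim: s t => [|x s IH] [|y t] //=; rewrite !inE => /predU1P[->|/IH[-> ->]].
  by rewrite !eqxx.
by rewrite !orbT.
Qed.

Lemma exists_mem_zip s (t : seq T') x : size s = size t -> x \in s ->
  exists2 y, y \in t & (x, y) \in zip s t.
Proof.
elim: s t => [|u s IH] [|v t] //= [st]; rewrite inE => /predU1P[->|/(IH _ st)[y yt xy]].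
  by exists v; rewrite mem_head.
by exists y; rewrite inE ?yt ?xy orbT.
Qed.

(** Serves to compare the Kronecker deltas of two Gram matrices entry by entry. *)
Lemma mem_zip_eq s (t : seq T') z w : uniq s -> uniq t ->
  z \in zip s t -> w \in zip s t -> (z.1 == w.1) = (z.2 == w.2).
Proof.
elim: s t => [|x s IH] [|y t] //= /andP[xs us] /andP[yt ut]; rewrite !inE.
move=> /predU1P[->|zst] /predU1P[->|wst] /=; rewrite ?eqxx //; last exact: (IH t).
- have [ws wt] := mem_zip wst.
  by rewrite (negbTE (memPnC xs _ ws)) (negbTE (memPnC yt _ wt)).
have [zs zt] := mem_zip zst.
by rewrite (negbTE (memPn xs _ zs)) (negbTE (memPn yt _ zt)).
Qed.
End Sequences.

Lemma mem_zip_map (T1 T2 S1 S2 : eqType) (f : T1 -> S1) (g : T2 -> S2) s t z :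
  z \in zip s t -> (f z.1, g z.2) \in zip (map f s) (map g t).
Proof.
elim: s t => [|x s IH] [|y t] //=; rewrite !inE => /predU1P[->|/IH ->].
  by rewrite eqxx.
by rewrite orbT.
Qed.

Lemma free_subseq (K : fieldType) (V : vectType K) (s t : seq V) :
  subseq s t -> free t -> free s.
Proof.
by move=> st ft; rewrite (subseq_uniqP (free_uniq ft) st) filter_free.
Qed.

(** * Symmetric forms and definite subspaces *)

Section SymmetricForms.
Variables (R : realType) (V : vectType R) (B : {symmetric V}).
Implicit Types (X Y Z U : {vspace V}) (x y z u v : V) (s t P N : seq V).

Lemma sformC x y : B x y = B y x.
Proof. by rewrite hermC expr0 mul1r. Qed.

Lemma sformDl x y z : B (x + y) z = B x z + B y z.
Proof. exact: linearDl. Qed.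

Lemma sformDr x y z : B x (y + z) = B x y + B x z.
Proof. exact: linearDr. Qed.

Lemma sformZl k x y : B (k *: x) y = k * B x y.
Proof. exact: linearZl_LR. Qed.

Lemma sformZr k x y : B x (k *: y) = k * B x y.
Proof. exact: linearZr_LR. Qed.

Lemma sform_suml I (r : seq I) (p : pred I) (E : I -> V) z :
  B (\sum_(i <- r | p i) E i) z = \sum_(i <- r | p i) B (E i) z.
Proof. exact: linear_sumlz. Qed.

Lemma sform_sumr I (r : seq I) (p : pred I) (E : I -> V) z :
  B z (\sum_(i <- r | p i) E i) = \sum_(i <- r | p i) B z (E i).
Proof. exact: linear_sumr. Qed.

Lemma sform_span0 s x : {in s, forall y, B x y = 0} -> {in <<s>>%VS, forall y, B x y = 0}.
Proof.
move=> s0; apply/mem_orthovP; rewrite mem_orthov_sym; apply/span_subvP => y ys.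
by rewrite mem_orthov1 sformC s0.
Qed.

(** A vector in the left kernel of the Gram matrix of a basis of [U] would give an element of the
    radical, so this matrix is invertible; its inverse turns the values of [f] on the basis into the
    coordinates of [u]. *)
Lemma riesz U (f : 'Hom(V, R^o)) :
  radical B U = 0%VS -> exists2 u, u \in U & {in U, forall x, B u x = f x}.
Proof.
move=> U0; set b := vbasis U.
have bU i : b`_i \in U by case: (ltnP i (\dim U)) => h;
  [apply/vbasis_mem/mem_nth; rewrite size_tuple | rewrite nth_default ?mem0v ?size_tuple].
pose G : 'M[R]_(\dim U) := \matrix_(i, j) B b`_i b`_j.
have Gu : G \in unitmx.
  rewrite -row_free_unit; apply: inj_row_free => c cG.
  have c0 : \sum_i c 0 i *: b`_i = 0.
    apply/eqP; rewrite -memv0 -U0 memv_cap memv_suml => [|i _]; last by rewrite memvZ.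
    apply/mem_orthovP => x xU; apply: (sform_span0 (s := b)); last first.
      by rewrite (span_basis (vbasisP U)).
    move=> _ /(nthP 0)[j jlt <-]; rewrite size_tuple in jlt.
    move/matrixP: cG => /(_ 0 (Ordinal jlt)); rewrite !mxE => <-.
    by rewrite linear_sumlz; apply: eq_bigr => i _; rewrite mxE; apply: sformZl.
  have /freeP fb : free b by exact: basis_free (vbasisP U).
  by apply/rowP => i; rewrite mxE (fb _ c0).
pose c := (\row_j f b`_j) *m invmx G.
exists (\sum_i c 0 i *: b`_i) => [|x xU]; first by rewrite memv_suml // => i _; rewrite memvZ.
rewrite (coord_vbasis xU) linear_sumr linear_sum /=; apply: eq_bigr => j _.
rewrite sformZr linearZ /=; congr (_ * _).
have /matrixP/(_ 0 j) : c *m G = \row_j f b`_j by rewrite mulmxKV.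
rewrite [LHS]mxE [RHS]mxE => <-; rewrite linear_sumlz; apply: eq_bigr => i _.
by rewrite [G i j]mxE; apply: sformZl.
Qed.

(** The component of [x] along [Y] is the vector of [Y] that represents the functional [B x] on
    [Y]. *)
Lemma orth_split X Y : radical B Y = 0%VS -> (Y <= X)%VS ->
  (Y + (X :&: orthov B Y))%VS = X /\ (Y :&: (X :&: orthov B Y))%VS = 0%VS.
Proof.
move=> Y0 YX; split; last first.
  by apply/eqP; rewrite -subv0 -Y0 capvS // capvSr.
apply/eqP; rewrite eqEsubv subv_add YX capvSl /=; apply/subvP => x xX.
have [u uY uE] := riesz (linfun (B x : V -> R^o)) Y0.
rewrite -(subrKC u x) memv_add // memv_cap memvB ?(subvP YX u) //=.
by apply/mem_orthovP => y yY; rewrite linearBl /= uE // lfunE subrr.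
Qed.

Lemma dim_orth_split X Y : radical B Y = 0%VS -> (Y <= X)%VS ->
  (\dim Y + \dim (X :&: orthov B Y))%N = \dim X.
Proof.
by move=> Y0 YX; have [{3}<- XY0] := orth_split Y0 YX; rewrite dimv_disjoint_sum.
Qed.

(** The factor [e] lets one statement serve positive definite ([e = 1]) and negative definite
    ([e = -1]) subspaces. *)
Lemma radical_definite e X :
  {in X, forall x, x != 0 -> 0 < e * B x x} -> radical B X = 0%VS.
Proof.
move=> eX; apply/eqP; rewrite -subv0; apply/subvP => x; rewrite memv_cap memv0.
case/andP=> xX /mem_orthovP/(_ x xX) x0; apply: contraT => /(eX x xX).
by rewrite x0 mulr0 ltxx.
Qed.

(** A nonzero common vector would have a norm of both signs, so [X] and [Y] are in direct sum inside
    [Z]. *)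
Lemma definite_semidefinite_dim e X Y Z : (X <= Z)%VS -> (Y <= Z)%VS ->
    {in X, forall x, x != 0 -> 0 < e * B x x} ->
    {in Y, forall x, e * B x x <= 0} ->
  (\dim X + \dim Y <= \dim Z)%N.
Proof.
move=> XZ YZ pX nY; rewrite -dimv_disjoint_sum ?dimvS ?subv_add ?XZ //.
apply/eqP; rewrite -subv0; apply/subvP => x; rewrite memv_cap memv0 => /andP[xX /nY].
by apply: contraTT => /(pX x xX); rewrite ltNge.
Qed.

(* By maximality of Y the form has the other sign on its orthogonal in X, which
   therefore meets D trivially. *)
Lemma maximal_definite_dim e X Y D M :
    (Y <= X)%VS -> {in Y, forall x, x != 0 -> 0 < e * B x x} ->
    (forall Z, (Z <= X)%VS -> {in Z, forall x, x != 0 -> 0 < e * B x x} ->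
       (Y <= Z)%VS -> Z = Y) ->
    (D <= X)%VS -> {in D, forall x, x != 0 -> 0 < e * B x x} ->
    (M <= X)%VS -> {in M, forall x, e * B x x <= 0} ->
    (\dim D + \dim M = \dim X)%N ->
  \dim Y = \dim D.
Proof.
move=> YX pY maxY DX pD MX nM dX; apply/eqP; rewrite eqn_leq; apply/andP; split.
  by rewrite -(leq_add2r (\dim M)) dX; apply: (definite_semidefinite_dim (e := e)).
have Y0 := radical_definite pY.
rewrite -(leq_add2r (\dim (X :&: orthov B Y))) dim_orth_split //.
apply: (definite_semidefinite_dim (e := e)) => //; first exact: capvSl.
move=> x; rewrite memv_cap => /andP[xX /mem_orthovP xY]; rewrite leNgt; apply/negP => px.
(* Were the norm of [x] of sign [e], adjoining [x] would keep [Y] definite; maximality then puts [x]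
   in [Y], where it is orthogonal to itself. *)
have Yx : (Y + <[x]>)%VS = Y.
  apply: maxY; rewrite ?subv_add ?YX ?addvSl // => _ /memv_addP[y yY [_ /vlineP[k ->] ->]] yk0.
  have -> : e * B (y + k *: x) (y + k *: x) = e * B y y + k ^+ 2 * (e * B x x).
    rewrite !(sformDl, sformDr, sformZl, sformZr) (sformC y x) (xY y yY); ring.
  case: (eqVneq y 0) yk0 => [->|yn0 _].
    rewrite add0r scaler_eq0 negb_or linear0r mulr0 add0r => /andP[k0 _].
    by rewrite mulr_gt0 // exprn_even_gt0.
  by rewrite ltr_pwDl ?pY // mulr_ge0 ?sqr_ge0 // ltW.
have xinY : x \in Y by rewrite -Yx memvE addvSr.
by move: px; rewrite (xY x) // mulr0 ltxx.
Qed.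
End SymmetricForms.

(** * Diagonalizing bases sorted by sign *)

Section SignedFrames.
Variables (R : realType) (V : vectType R) (B : {symmetric V}).
Implicit Types (e : R) (X Y : {vspace V}) (x y z : V) (Z P N : seq V).

(** A diagonal form of [B] on the span, with [Z] in the radical of that span. The sign [e] makes
    statements on [P] and on [N] instances of one another. Linear independence is carried
    separately. *)
Definition signed_frame e Z P N :=
  [/\ {in Z & Z ++ P ++ N, forall x y, B x y = 0},
      {in P &, forall x y, B x y = e * (x == y)%:R},
      {in N &, forall x y, B x y = - e * (x == y)%:R}
    & {in P & N, forall x y, B x y = 0}].

Lemma signed_frameC e Z P N : signed_frame e Z P N -> signed_frame (- e) Z N P.
Proof.
case=> [fZ fP fN fPN]; split=> //.
- move=> x y xZ yZNP; apply: fZ => //; move: yZNP; rewrite !mem_cat.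
  by case/or3P=> ->; rewrite ?orbT.
- by move=> x y xP yP; rewrite fP // opprK.
- by move=> x y xN yP; rewrite sformC fPN.
Qed.

(** In the coordinates given by [P], the form [e * B x x] is a sum of squares. *)
Lemma span_orthonormal_definite e P : e * e = 1 -> free P ->
    {in P &, forall x y, B x y = e * (x == y)%:R} ->
  {in <<P>>%VS, forall x, x != 0 -> 0 < e * B x x}.
Proof.
move=> e1 fP oP x /(free_span fP)[k -> _].
have -> : e * B (\sum_(y <- P) k y *: y) (\sum_(y <- P) k y *: y) = \sum_(y <- P) k y ^+ 2.
  rewrite linear_sumlz mulr_sumr; apply: eq_big_seq => y yP.
  rewrite linear_sumr (bigD1_seq y yP (free_uniq fP)) /= big1_seq.
    by rewrite sformZl sformZr oP // eqxx mulr1 addr0 mulrCA [e * _]mulrCA e1 mulr1.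
  by move=> z /andP[zy zP]; rewrite sformZl sformZr oP // eq_sym (negPf zy) !mulr0.
move=> nz; rewrite lt_def sumr_ge0 ?andbT => [|y _]; last exact: sqr_ge0.
apply: contraNneq nz => /eqP; rewrite psumr_eq0 => [/allP k0|y _]; last exact: sqr_ge0.
by rewrite big1_seq // => y /k0; rewrite /= sqrf_eq0 => /eqP->; rewrite scale0r.
Qed.

Lemma span_frame_semidefinite e Z P N : e * e = 1 -> free P ->
  signed_frame e Z P N -> {in <<Z ++ P>>%VS, forall x, 0 <= e * B x x}.
Proof.
move=> e1 fP [fZ oP _ _] x; rewrite span_cat => /memv_addP[z zZ [p pP ->]].
have zZ0 y : y \in Z ++ P -> B z y = 0.
  move=> yZP; rewrite sformC; apply: (sform_span0 (s := Z)) => // t tZ.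
  by rewrite sformC fZ // catA mem_cat yZP.
have zz : B z z = 0 by apply: (sform_span0 (s := Z)) => // t tZ; rewrite zZ0 ?mem_cat ?tZ.
have zp : B z p = 0.
  by apply: (sform_span0 (s := P)) => // t tP; rewrite zZ0 ?mem_cat ?tP ?orbT.
rewrite sformDl !sformDr (sformC B p) zz zp !add0r.
have [->|pn0] := eqVneq p 0; first by rewrite linear0r mulr0.
exact/ltW/(span_orthonormal_definite e1 fP oP).
Qed.

(** The definite span of [P] and the semidefinite span of [Z ++ N] have complementary dimensions in
    [X], which fixes the dimension of every maximal definite subspace. *)
Lemma frame_index e Z P N X Y : e * e = 1 -> signed_frame e Z P N ->
    basis_of X (Z ++ P ++ N) -> (Y <= X)%VS ->
    {in Y, forall x, x != 0 -> 0 < e * B x x} ->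
    (forall D : {vspace V}, (D <= X)%VS -> {in D, forall x, x != 0 -> 0 < e * B x x} ->
       (Y <= D)%VS -> D = Y) ->
  \dim Y = size P.
Proof.
move=> e1 fr bX YX pY maxY.
have [/catr_free/[dup]fPN/catl_free fP fZPN] := (basis_free bX, basis_free bX).
have fN := catr_free fPN.
have fZN : free (Z ++ N).
  by move: fZPN; rewrite (perm_free (permEl (perm_catCA Z P N))) => /catr_free.
have sub s : {subset s <= Z ++ P ++ N} -> (<<s>> <= X)%VS.
  by rewrite -(span_basis bX); apply: sub_span.
rewrite -(eqnP fP); apply: (maximal_definite_dim YX pY maxY (M := <<Z ++ N>>)).
- by apply: sub => x; rewrite !mem_cat => ->; rewrite /= ?orbT.
- by apply: span_orthonormal_definite => //; case: fr.
- by apply: sub => x; rewrite !mem_cat => /orP[] ->; rewrite /= ?orbT.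
- move=> x xZN; have := span_frame_semidefinite _ fN (signed_frameC fr) xZN.
  by rewrite mulrNN mulNr oppr_ge0; apply.
- rewrite (eqnP fP) (eqnP fZN) -(span_basis bX) (eqnP fZPN) !size_cat; lia.
Qed.

(** Two dimension counts in the larger span: [Z' ++ P'] spans a semidefinite subspace against the
    definite span of [N], and [P'] a definite one against the semidefinite span of [Z ++ N]. *)
Lemma frame_le e Z P N Z' P' N' : e * e = 1 ->
    signed_frame e Z P N -> signed_frame e Z' P' N' ->
    free (Z ++ P ++ N) -> free (Z' ++ P' ++ N') ->
    (<<Z' ++ P' ++ N'>> <= <<Z ++ P ++ N>>)%VS ->
  (size Z' + size P' <= size Z + size P)%N /\ (size P' <= size P)%N.
Proof.
move=> e1 fr fr' f f' sub.
have ZPN t : {subset t <= Z ++ P ++ N} -> (<<t>> <= <<Z ++ P ++ N>>)%VS.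
  exact: sub_span.
have ZPN' t : {subset t <= Z' ++ P' ++ N'} -> (<<t>> <= <<Z ++ P ++ N>>)%VS.
  by move=> tt; apply: subv_trans sub; apply: sub_span.
have fP := catl_free (catr_free f); have fN := catr_free (catr_free f).
have fP' := catl_free (catr_free f').
have fZP' : free (Z' ++ P') by move: f'; rewrite catA => /catl_free.
have fZN : free (Z ++ N).
  by move: f; rewrite (perm_free (permEl (perm_catCA Z P N))) => /catr_free.
have eN : - e * - e = 1 by rewrite mulrNN.
split.
  have := @definite_semidefinite_dim _ _ B (- e) <<N>> <<Z' ++ P'>> <<Z ++ P ++ N>>.
  rewrite (eqnP fN) (eqnP fZP') (eqnP f) !size_cat => H.
  suff: (size N + (size Z' + size P') <= size Z + (size P + size N))%N by lia.
  apply: H.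
  - by apply: ZPN => x; rewrite !mem_cat => ->; rewrite /= ?orbT.
  - by apply: ZPN' => x; rewrite !mem_cat => /orP[] ->; rewrite /= ?orbT.
  - by apply: span_orthonormal_definite => //; case: fr.
  - move=> x xZP; have := span_frame_semidefinite e1 fP' fr' xZP.
    by rewrite mulNr oppr_le0.
have := @definite_semidefinite_dim _ _ B e <<P'>> <<Z ++ N>> <<Z ++ P ++ N>>.
rewrite (eqnP fP') (eqnP fZN) (eqnP f) !size_cat => H.
suff: (size P' + (size Z + size N) <= size Z + (size P + size N))%N by lia.
apply: H.
- by apply: ZPN' => x; rewrite !mem_cat => ->; rewrite /= ?orbT.
- by apply: ZPN => x; rewrite !mem_cat => /orP[] ->; rewrite /= ?orbT.
- by apply: span_orthonormal_definite => //; case: fr'.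
- move=> x xZN; have := span_frame_semidefinite eN fN (signed_frameC fr) xZN.
  by rewrite mulNr oppr_ge0.
Qed.

(** If [x] and [y] are null but not orthogonal, then [x + y] has norm [2 * B x y], which is nonzero;
    a non-null vector is then rescaled. *)
Lemma unit_vector_exists X : ~~ (X <= orthov B X)%VS ->
  exists2 x, x \in X & B x x * B x x = 1.
Proof.
move=> nX.
have [x xX xx] : exists2 x, x \in X & B x x != 0.
  have [x xX /mem_orthovPn[y yX xy]] := subvPn nX.
  have [xx|] := eqVneq (B x x) 0; last by exists x.
  have [yy|] := eqVneq (B y y) 0; last by exists y.
  exists (x + y); first exact: memvD.
  rewrite !(sformDl, sformDr) xx yy (sformC B y x) addr0 add0r -mulr2n.
  by rewrite mulrn_eq0 negb_or.
exists ((Num.sqrt `|B x x|)^-1 *: x); first exact: memvZ.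
have -> : B ((Num.sqrt `|B x x|)^-1 *: x) ((Num.sqrt `|B x x|)^-1 *: x) = B x x / `|B x x|.
  by rewrite sformZl sformZr mulrA -expr2 exprVn sqr_sqrtr // mulrC.
by rewrite -expr2 expr_div_n -normrX ger0_norm ?sqr_ge0 // divff // sqrf_eq0.
Qed.

(** Gram-Schmidt by induction on the dimension: a vector of norm 1 or -1 is split off, and its
    orthogonal complement in [X] keeps the same radical. *)
Lemma frame_exists X Z : basis_of (radical B X) Z ->
  exists P N, signed_frame 1 Z P N /\ basis_of X (Z ++ P ++ N).
Proof.
elim/ltn_ind: {X}(\dim X) {-2}X (erefl (\dim X)) => n IH X dX bZ.
case: (boolP (X <= orthov B X)%VS) => [isoX|/unit_vector_exists[x xX xx1]].
  (* An isotropic [X] is its own radical, so [Z] alone is a basis. *)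
  move: bZ; rewrite /radical (capv_idPl isoX) => bZ.
  exists [::], [::]; rewrite !cats0; split=> //; split=> // x y xZ yZ.
  by rewrite !cats0 in yZ; apply: (orthovP isoX); apply: basis_mem bZ _.
have x0 : x != 0.
  by apply: contra_eq_neq xx1 => ->; rewrite linear0r mulr0 eq_sym oner_eq0.
have rx : radical B <[x]> = 0%VS.
  apply: (radical_definite (e := B x x)) => _ /vlineP[k ->]; rewrite scaler_eq0 negb_or.
  case/andP=> k0 _; rewrite sformZl sformZr !(mulrCA (B x x)) xx1 mulr1 -expr2.
  by rewrite exprn_even_gt0.
have sxX : (<[x]> <= X)%VS by [].
have [defX dxX] := orth_split rx sxX; have dimX := dim_orth_split rx sxX.
set X1 := (X :&: orthov B <[x]>)%VS in defX dxX dimX.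
have xX1 y : y \in X1 -> B x y = 0.
  by rewrite memv_cap mem_orthov1 sformC => /andP[_ /eqP].
have radX1 : radical B X1 = radical B X.
  apply/vspaceP => v; rewrite !memv_cap; apply/andP/andP => [[/andP[vX vx] /mem_orthovP vX1]|].
    split=> //; apply/mem_orthovP => y; rewrite -defX.
    move=> /memv_addP[_ /vlineP[k ->] [t tX1 ->]]; rewrite mem_orthov1 in vx.
    by rewrite sformDr (vX1 t) // sformZr (eqP vx) mulr0 addr0.
  case=> vX /mem_orthovP vX'; rewrite vX mem_orthov1 vX' // eqxx; split=> //.
  by apply/mem_orthovP => y; rewrite memv_cap => /andP[yX _]; apply: vX'.
have [||P [N [fr bX1]]] := IH (\dim X1) _ X1 erefl.
- by rewrite -dX -dimX dim_vline x0.
- by rewrite radX1.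
have bX : basis_of X (x :: Z ++ P ++ N).
  rewrite -defX -cat1s; apply: cat_basis => //; last exact: seq1_basis.
  exact/directv_addP.
have [fZ oP oN oPN] := fr.
have X1b y : y \in Z ++ P ++ N -> B x y = 0 by move=> /(basis_mem bX1)/xX1.
have xnot : x \notin Z ++ P ++ N.
  by have := basis_free bX; rewrite free_cons => /andP[+ _]; apply/contra/memv_span.
have [e1|e1] : B x x = 1 \/ B x x = -1.
  by apply/pred2P; rewrite /= -eqf_sqr expr2 xx1 expr1n.
- exists (x :: P), N; split; last first.
    by rewrite -(perm_basis _ (permEl (perm_catCA [:: x] Z (P ++ N)))).
  split=> // y z.
  + move=> yZ; rewrite !mem_cat inE -!orbA orbCA -!mem_cat => /predU1P[->|]; last exact: fZ.
    by rewrite sformC X1b // mem_cat yZ.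
  + have neqx t : t \in P -> (x == t) = false.
      by move=> tP; apply: contraNF xnot => /eqP->; rewrite !mem_cat tP orbT.
    rewrite !inE => /predU1P[->|yP] /predU1P[->|zP]; rewrite ?mul1r ?eqxx //.
    * by rewrite neqx // X1b // !mem_cat zP orbT.
    * by rewrite eq_sym neqx // sformC X1b // !mem_cat yP orbT.
    * by rewrite oP // mul1r.
  + by rewrite inE => /predU1P[->|yP] zN; [rewrite X1b // !mem_cat zN !orbT | apply: oPN].
- exists P, (x :: N); split; last first.
    have := permEl (perm_catCA [:: x] (Z ++ P) N).
    by rewrite -!catA => pxN; rewrite -(perm_basis _ pxN).
  split=> // y z.
  + move=> yZ; rewrite !mem_cat inE [(z \in P) || _]orbCA orbCA -!mem_cat.
    move=> /predU1P[->|]; last exact: fZ.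
    by rewrite sformC X1b // mem_cat yZ.
  + have neqx t : t \in N -> (x == t) = false.
      by move=> tP; apply: contraNF xnot => /eqP->; rewrite !mem_cat tP !orbT.
    rewrite !inE => /predU1P[->|yP] /predU1P[->|zP]; rewrite ?mulN1r ?eqxx //.
    * by rewrite neqx // oppr0 X1b // !mem_cat zP !orbT.
    * by rewrite eq_sym neqx // oppr0 sformC X1b // !mem_cat yP !orbT.
    * by rewrite oN // mulN1r.
  + move=> yP; rewrite inE => /predU1P[->|zN]; last exact: oPN.
    by rewrite sformC X1b // !mem_cat yP orbT.
Qed.
End SignedFrames.

(** * Witt's extension theorem *)

Section Witt.
Variables (R : realType) (V : vectType R) (B : {symmetric V}).
Implicit Types (U X Y : {vspace V}) (x y u v : V) (zs : seq (V * V)).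

Lemma frame_exists_sign e X : e * e = 1 -> radical B X = 0%VS ->
  exists P N, signed_frame B e [::] P N /\ basis_of X (P ++ N).
Proof.
move=> e1 X0; have [|P [N [fr bX]]] := @frame_exists _ _ B X [::].
  by rewrite X0; apply: nil_basis.
have [->|->] : e = 1 \/ e = -1.
- by apply/pred2P; rewrite /= -eqf_sqr expr2 e1 expr1n.
- by exists P, N.
exists N, P; split; first exact: signed_frameC.
by rewrite (perm_basis _ (permEl (perm_catC N P))).
Qed.

(** A list of pairs encodes a partial isometry by its graph on a basis; agreement of the Gram
    matrices passes to the span by bilinearity. *)
Lemma isometry_of_pairs zs : free (unzip1 zs) ->
    {in zs &, forall z t, B z.1 t.1 = B z.2 t.2} ->
  exists g : 'End(V), [/\ {in zs, forall z, g z.1 = z.2},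
    (g @: <<unzip1 zs>>)%VS = <<unzip2 zs>>%VS &
    {in <<unzip1 zs>>%VS &, forall x y, B (g x) (g y) = B x y}].
Proof.
move=> f1 gram; have [g /(_ f1) gE] := linear_of_free (unzip1 zs) (unzip2 zs).
have {}gE : map g (unzip1 zs) = unzip2 zs by apply: gE; rewrite !size_map.
have gz : {in zs, forall z, linfun g z.1 = z.2}.
  have /eq_in_map gz : map (g \o fst) zs = map snd zs by rewrite map_comp.
  by move=> z /gz; rewrite lfunE.
exists (linfun g); split=> //.
  by rewrite limg_span -gE; congr <<_>>%VS; apply: eq_map => x; rewrite lfunE.
move=> x y /(free_span f1)[k -> _] /(free_span f1)[l -> _].
rewrite !(linear_sum (linfun g)) !sform_suml; apply: eq_big_seq => _ /mapP[z zzs ->].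
rewrite !sform_sumr; apply: eq_big_seq => _ /mapP[t tzs ->].
by rewrite !(linearZ_LR (linfun g)) /= !sformZl !sformZr !gz // gram.
Qed.

Lemma represent_values U (s : seq V) (c : seq R) :
    radical B U = 0%VS -> {subset s <= U} -> free s -> size c = size s ->
  exists2 u, u \in U & map (B u) s = c.
Proof.
move=> U0 sU fs sc; have [g /(_ fs sc) gE] := linear_of_free s (c : seq R^o).
have [u uU uE] := riesz (linfun g) U0; exists u => //.
by rewrite -gE; apply/eq_in_map => x /sU xU; rewrite uE // lfunE.
Qed.

Lemma radical_orth U X : radical B U = 0%VS -> radical B X = 0%VS -> (X <= U)%VS ->
  radical B (U :&: orthov B X)%VS = 0%VS.
Proof.
move=> U0 X0 XU; apply/eqP; rewrite -subv0 -U0; apply/subvP => x.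
rewrite !memv_cap => /andP[/andP[xU /mem_orthovP xX] /mem_orthovP xX']; rewrite xU.
apply/mem_orthovP => y; have [<- _] := orth_split X0 XU.
by move=> /memv_addP[v /xX xv [t /xX' xt ->]]; rewrite sformDr xv xt addr0.
Qed.

(* A vector u not orthogonal to some n in the radical lies outside the span; its
   partner is corrected by a multiple of the image of n to get the same norm. *)
Lemma witt_step_degenerate U zs : radical B U = 0%VS ->
    {subset unzip1 zs <= U} -> {subset unzip2 zs <= U} ->
    free (unzip1 zs) -> free (unzip2 zs) ->
    {in zs &, forall z t, B z.1 t.1 = B z.2 t.2} ->
    radical B <<unzip1 zs>> != 0%VS ->
  exists u u', [/\ u \in U, u' \in U,
    u \notin <<unzip1 zs>>%VS /\ u' \notin <<unzip2 zs>>%VS, B u u = B u' u' &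
    {in zs, forall z, B u z.1 = B u' z.2}].
Proof.
move=> U0 s1 s2 f1 f2 gram; have [g [gz gX gB]] := isometry_of_pairs f1 gram.
rewrite -vpick0; set n := vpick _ => n0.
have := memv_pick (radical B <<unzip1 zs>>).
rewrite -/n memv_cap => /andP[nX /mem_orthovP nX0].
have s1X z : z \in zs -> z.1 \in <<unzip1 zs>>%VS by move=> h; apply/memv_span/map_f.
have nU : n \in U by move: nX; apply/subvP/span_subvP.
have [u uU un] : exists2 u, u \in U & B n u != 0.
  apply/mem_orthovPn; apply: contra n0 => nU'.
  by rewrite -memv0 -U0 memv_cap nU.
have [|v vU vE] := @represent_values U _ (map (B u) (unzip1 zs)) U0 s2 f2.
  by rewrite !size_map.
have vz : {in zs, forall z, B v z.2 = B u z.1}.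
  by apply/eq_in_map; rewrite (map_comp (B v) snd) vE -map_comp.
have vX : {in <<unzip1 zs>>%VS, forall x, B v (g x) = B u x}.
  move=> x /(free_span f1)[k -> _].
  rewrite (linear_sum g) !sform_sumr; apply: eq_big_seq => _ /mapP[z zzs ->].
  by rewrite (linearZ_LR g) /= !sformZr gz // vz.
have gnX x : x \in <<unzip1 zs>>%VS -> B (g n) (g x) = 0 by move=> xX; rewrite gB // nX0.
have gnU : g n \in U.
  have : g n \in (g @: <<unzip1 zs>>)%VS by apply: memv_img.
  by rewrite gX; apply/subvP/span_subvP.
(* As [g n] is null and [B v (g n) = B u n], the norm of [v + k *: g n] is [B v v + 2 * k * B u n];
   this [k] makes it [B u u]. *)
pose k := (B u u - B v v) / (2 * B n u).
exists u, (v + k *: g n); split=> //.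
- by rewrite memvD ?memvZ.
- split; first by apply: contra un => /nX0/eqP.
  (* If the partner were some [g x], pairing it with [g n] would give [B u n = 0]. *)
  rewrite -gX; apply: contra un => /memv_imgP[x xX vk].
  have := gnX x xX; rewrite -vk sformDr sformZr gnX // mulr0 addr0 sformC vX // sformC.
  by move->.
- rewrite !(sformDl, sformDr, sformZl, sformZr) (sformC B (g n) v) vX // gnX //.
  by rewrite (sformC B u n) /k; field.
- by move=> z zzs; rewrite sformDl sformZl -{2}(gz z zzs) gnX ?s1X // mulr0 addr0 vz.
Qed.

(* Take u in the orthogonal X' of the first span, of norm 1 or -1.  If no vector of
   the orthogonal Y' of the second span had a norm of that sign, a maximal definite
   subspace of the first span, enlarged by u, and the sum of Y' with the image of a
   complement of opposite sign would be too large to be in direct sum. *)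
Lemma witt_step_nondegenerate U zs : radical B U = 0%VS ->
    {subset unzip1 zs <= U} -> {subset unzip2 zs <= U} ->
    free (unzip1 zs) -> free (unzip2 zs) ->
    {in zs &, forall z t, B z.1 t.1 = B z.2 t.2} ->
    radical B <<unzip1 zs>> = 0%VS -> (size zs < \dim U)%N ->
  exists u u', [/\ u \in U, u' \in U,
    u \notin <<unzip1 zs>>%VS /\ u' \notin <<unzip2 zs>>%VS, B u u = B u' u' &
    {in zs, forall z, B u z.1 = B u' z.2}].
Proof.
move=> U0 s1 s2 f1 f2 gram X0 ltzs; have [g [gz gX gB]] := isometry_of_pairs f1 gram.
set X := <<unzip1 zs>>%VS in gX gB X0 *; set Y := <<unzip2 zs>>%VS in gX *.
have XU : (X <= U)%VS by apply/span_subvP.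
have YU : (Y <= U)%VS by apply/span_subvP.
have dX : \dim X = size zs by rewrite (eqnP f1) size_map.
have dY : \dim Y = size zs by rewrite (eqnP f2) size_map.
have Y0 : radical B Y = 0%VS.
  apply/eqP; rewrite -subv0; apply/subvP => y; rewrite memv_cap -gX.
  case/andP=> /memv_imgP[x xX ->] /mem_orthovP gx.
  have : x \in radical B X.
    rewrite memv_cap xX; apply/mem_orthovP => t tX.
    by rewrite -gB // gx ?memv_img.
  by rewrite X0 memv0 => /eqP->; rewrite linear0 mem0v.
have [_ XX'] := orth_split X0 XU; have [_ YY'] := orth_split Y0 YU.
have dX' := dim_orth_split X0 XU; have dY' := dim_orth_split Y0 YU.
have radX' := radical_orth U0 X0 XU.
set X' := (U :&: orthov B X)%VS in XX' dX' radX'; set Y' := (U :&: orthov B Y)%VS in YY' dY'.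
(* [X'] has positive dimension and trivial radical, so it is not isotropic. *)
have [|u uX' uu] := @unit_vector_exists _ _ B X'.
  apply/negP => /capv_idPl; rewrite -/(radical B X') radX' => X'0.
  by move: dX'; rewrite -X'0 dimv0 addn0 dX => eqU; rewrite eqU ltnn in ltzs.
have u0 : u != 0.
  by apply: contra_eq_neq uu => ->; rewrite linear0r mulr0 eq_sym oner_eq0.
have notin0 T T' v : (T :&: T' = 0)%VS -> v \in T' -> v != 0 -> v \notin T.
  by move=> TT' vT'; apply: contra => vT; rewrite -memv0 -TT' memv_cap vT.
suff [v vY' vv] : exists2 v, v \in Y' & B u u = B v v.
  exists u, v; move: (uX') (vY'); rewrite !memv_cap => /andP[uU /mem_orthovP uX].
  case/andP=> vU /mem_orthovP vY; split=> //.
    have v0 : v != 0.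
      apply: contraNneq u0 => v0; apply: contra_eqT uu => _.
      by rewrite vv v0 linear0r mulr0 eq_sym oner_eq0.
    by split; [apply: (notin0 _ X') | apply: (notin0 _ Y')].
  move=> z zzs; rewrite uX; last by apply/memv_span/map_f.
  by rewrite vY //; apply/memv_span/map_f.
(* A vector of [Y'] whose norm has the sign of [B u u] only has to be rescaled; the other case is
   refuted by counting dimensions. *)
have [[v vY' vpos]|Y'neg] := pselect (exists2 v, v \in Y' & 0 < B u u * B v v).
  exists ((Num.sqrt (B u u * B v v))^-1 *: v); first exact: memvZ.
  rewrite sformZl sformZr mulrA -expr2 exprVn sqr_sqrtr ?ltW //.
  rewrite invfM -mulrA mulVf ?mulr1; last by apply: contraTneq vpos => ->; rewrite mulr0 ltxx.
  by apply: (mulfI (x := B u u)); rewrite ?uu ?divff //; apply: contra_eq_neq uu => ->;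
    rewrite mulr0 eq_sym oner_eq0.
exfalso.
have [P [N [fr bX]]] := frame_exists_sign uu X0; have [_ oP _ _] := fr.
have [fP fN] : free P /\ free N.
  by split; [apply: catl_free (basis_free bX) | apply: catr_free (basis_free bX)].
have PX : (<<P>> <= X)%VS.
  by rewrite -(span_basis bX) span_cat addvSl.
have NX : (<<N>> <= X)%VS.
  by rewrite -(span_basis bX) span_cat addvSr.
move: (uX'); rewrite memv_cap => /andP[uU /mem_orthovP uX].
have fuP : free (u :: P).
  by rewrite free_cons fP andbT; apply: contra (notin0 _ _ _ XX' uX' u0); apply/subvP.
(* A vector of [X] killed by the isometry [g] lies in the radical of [X], which is trivial. *)
have gN : \dim (g @: <<N>>)%VS = size N.
  rewrite -(eqnP fN) limg_dim_eq //; apply/eqP; rewrite -subv0 -X0; apply/subvP => x.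
  rewrite !memv_cap memv_ker => /andP[/(subvP NX) xX /eqP gx0]; rewrite xX.
  by apply/mem_orthovP => t tX; rewrite -gB // gx0 linear0l.
have gNY : (g @: <<N>> <= Y)%VS by rewrite -gX limgS.
have dimM : \dim (g @: <<N>> + Y')%VS = (size N + \dim Y')%N.
  rewrite dimv_disjoint_sum ?gN //; apply/eqP; rewrite -subv0 -YY'.
  by rewrite capvS.
have := @definite_semidefinite_dim _ _ B (B u u) <<u :: P>> (g @: <<N>> + Y')%VS U.
rewrite dimM (eqnP fuP) /= => H.
(* Already [size P + size N + \dim Y'] equals [\dim U]; the extra unit from [u] is the
   contradiction. *)
suff : ((size P).+1 + (size N + \dim Y') <= \dim U)%N.
  have := size_basis (X := in_tuple (P ++ N)) bX; rewrite size_cat => dXPN.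
  by move: dY'; rewrite dY -dX dXPN => <-; rewrite addnA addSn ltnn.
apply: H.
- by rewrite span_cons subv_add -memvE uU (subv_trans PX).
- by rewrite subv_add (subv_trans gNY) //= capvSl.
- apply: span_orthonormal_definite => // x y; rewrite !inE.
  have up p : p \in P -> (u == p) = false /\ B u p = 0.
    move=> pP; split; last by apply: uX; apply: (subvP PX); apply: memv_span.
    by apply: contraTF fuP => /eqP ->; rewrite free_cons memv_span.
  move=> /predU1P[->|xP] /predU1P[->|yP]; last exact: oP.
  + by rewrite eqxx mulr1.
  + by have [-> ->] := up _ yP; rewrite mulr0.
  + by have [xu uxB] := up _ xP; rewrite eq_sym xu sformC uxB mulr0.
- move=> _ /memv_addP[_ /memv_imgP[t tN ->] [y yY' ->]].
  move: (yY'); rewrite memv_cap => /andP[_ /mem_orthovP yY].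
  have gtY : g t \in Y by apply: (subvP gNY); apply: memv_img.
  rewrite sformDl !sformDr (sformC B (g t) y) (yY _ gtY) addr0 add0r gB ?(subvP NX) // mulrDr.
  rewrite -oppr_ge0 opprD addr_ge0 //; last first.
    by rewrite oppr_ge0 leNgt; apply/negP => yp; apply: Y'neg; exists y.
  by rewrite -mulNr; apply: (span_frame_semidefinite _ fN (signed_frameC fr)); rewrite ?mulrNN.
Qed.

(** Induction on the codimension of the domain: one of the two preceding steps adds a pair to [zs],
    until the first components span [U]. *)
Theorem witt_extension U zs : radical B U = 0%VS ->
    {subset unzip1 zs <= U} -> {subset unzip2 zs <= U} ->
    free (unzip1 zs) -> free (unzip2 zs) ->
    {in zs &, forall z t, B z.1 t.1 = B z.2 t.2} ->
  exists2 g, isometry_group B U g & {in zs, forall z, g z.1 = z.2}.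
Proof.
move=> U0; move: {-1}(_ - _)%N (erefl (\dim U - size zs)%N) => n.
elim: n zs => [|n IH] zs dn s1 s2 f1 f2 gram.
  have [g [gz gX gB]] := isometry_of_pairs f1 gram.
  have eqU (s : seq V) : {subset s <= U} -> free s -> size s = size zs -> <<s>>%VS = U.
    move=> sU fs ss; apply/eqP; rewrite eqEdim (eqnP fs) ss -subn_eq0 dn eqxx andbT.
    exact/span_subvP.
  by exists g => //; split; [rewrite -{1}(eqU _ s1 f1) ?size_map // gX | move: gB];
    rewrite eqU ?size_map.
have ltzs : (size zs < \dim U)%N by rewrite -subn_gt0 dn.
have [u [u' [uU u'U [uX u'Y] uu uz]]] : exists u u', [/\ u \in U, u' \in U,
    u \notin <<unzip1 zs>>%VS /\ u' \notin <<unzip2 zs>>%VS, B u u = B u' u' &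
    {in zs, forall z, B u z.1 = B u' z.2}].
  case: (eqVneq (radical B <<unzip1 zs>>) 0%VS) => X0.
    exact: witt_step_nondegenerate.
  exact: witt_step_degenerate.
have [|||||| g gU gz] := IH ((u, u') :: zs).
- by rewrite /= subnS dn.
- by move=> x; rewrite inE => /predU1P[->|/s1].
- by move=> x; rewrite inE => /predU1P[->|/s2].
- by rewrite free_cons uX.
- by rewrite free_cons u'Y.
- move=> z t; rewrite !inE => /predU1P[->|zz] /predU1P[->|tz] //=; try exact: uz.
    by rewrite sformC uz // sformC.
  exact: gram.
by exists g => // z zzs; apply: gz; rewrite inE zzs orbT.
Qed.
End Witt.

(** * Frames seen through one projection *)

Section HalfFrames.
Variables (R : realType) (V : vectType R) (B : {symmetric V}).
Implicit Types (e : R) (p g : 'End(V)) (U : {vspace V}) (x y : V) (A C E P N Z : seq V).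

Lemma signed_frame_sub e Z P N Z' P' N' :
    {subset Z' <= Z} -> {subset P' <= P} -> {subset N' <= N} ->
  signed_frame B e Z P N -> signed_frame B e Z' P' N'.
Proof.
move=> sZ sP sN [fZ oP oN oPN]; split.
- move=> x y /sZ xZ yZ; apply: fZ => //; move: yZ; rewrite !mem_cat.
  by case/or3P=> [/sZ|/sP|/sN] ->; rewrite ?orbT.
- by move=> x y /sP xP /sP yP; apply: oP.
- by move=> x y /sN xP /sN yP; apply: oN.
- by move=> x y /sP xP /sN yP; apply: oPN.
Qed.

(** The Gram matrix of a signed frame without repetitions in [P] and [N] depends only on [e] and the
    three sizes. *)
Lemma signed_frame_gram e Z P N Z' P' N' :
    signed_frame B e Z P N -> signed_frame B e Z' P' N' ->
    uniq P -> uniq P' -> uniq N -> uniq N' ->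
    size Z = size Z' -> size P = size P' -> size N = size N' ->
  {in zip (Z ++ P ++ N) (Z' ++ P' ++ N') &, forall z t, B z.1 t.1 = B z.2 t.2}.
Proof.
move=> [fZ oP oN oPN] [fZ' oP' oN' oPN'] uP uP' uN uN' sZ sP sN z t.
have mZ w : w \in zip Z Z' -> w.1 \in Z /\ w.2 \in Z' by apply: mem_zip.
have mP w : w \in zip P P' -> w.1 \in P /\ w.2 \in P' by apply: mem_zip.
have mN w : w \in zip N N' -> w.1 \in N /\ w.2 \in N' by apply: mem_zip.
have mA w : w \in zip (Z ++ P ++ N) (Z' ++ P' ++ N') ->
    w.1 \in Z ++ P ++ N /\ w.2 \in Z' ++ P' ++ N' by apply: mem_zip.
move=> zA tA; have [z1A z2A] := mA _ zA; have [t1A t2A] := mA _ tA.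
move: zA tA; rewrite !zip_cat // !mem_cat.
case/or3P=> [/mZ[zZ zZ']|zP|zN]; first by rewrite fZ ?fZ'.
all: case/or3P=> [/mZ[tZ tZ']|tP|tN]; first by rewrite sformC fZ // sformC fZ'.
- have [[zP1 zP2] [tP1 tP2]] := (mP _ zP, mP _ tP).
  by rewrite oP // oP' // (mem_zip_eq uP uP' zP tP).
- by have [[zP1 zP2] [tN1 tN2]] := (mP _ zP, mN _ tN); rewrite oPN ?oPN'.
- by have [[zN1 zN2] [tP1 tP2]] := (mN _ zN, mP _ tP); rewrite sformC oPN // sformC oPN'.
have [[zN1 zN2] [tN1 tN2]] := (mN _ zN, mN _ tN).
by rewrite oN // oN' // (mem_zip_eq uN uN' zN tN).
Qed.

(** The lists live in [V] and only their images under [p] form a frame, so that the same vectors can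
    be tested against both projections. *)
Definition half_frame p e Z P N :=
  signed_frame B e (map p Z) (map p P) (map p N) /\ free (map p (Z ++ P ++ N)).

Lemma half_frame_perm p e Z Z' P N : perm_eq (map p Z) (map p Z') ->
  half_frame p e Z P N -> half_frame p e Z' P N.
Proof.
move=> ZZ' [fr f]; split.
  by apply: signed_frame_sub fr => // x; rewrite (perm_mem ZZ').
move: f; rewrite !map_cat (perm_free (Y := map p Z' ++ map p P ++ map p N)) //.
by rewrite perm_cat2r.
Qed.

Lemma half_frame_subseq p e Z Z' P P' N N' :
    subseq Z' Z -> subseq P' P -> subseq N' N ->
  half_frame p e Z P N -> half_frame p e Z' P' N'.
Proof.
move=> sZ sP sN [fr f]; split.
  by apply: signed_frame_sub fr; apply: mem_subseq; apply: map_subseq.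
by apply: free_subseq f; rewrite map_subseq // !cat_subseq.
Qed.

(** The images of [x] and [y] are orthogonal with norms [e] and [- e], so their sum is null, and it
    stays orthogonal to the remaining vectors. *)
Lemma half_frame_hyperbolic p e Z x y P N :
  half_frame p e Z (x :: P) (y :: N) -> half_frame p e (x + y :: Z) P N.
Proof.
case=> [fr f]; have pxy : p (x + y) = p x + p y by rewrite linearD.
have /= [uP uN] : uniq (map p (x :: P)) /\ uniq (map p (y :: N)).
  move: f; rewrite !map_cat => /catr_free/[dup]/catl_free/free_uniq uP.
  by move=> /catr_free/free_uniq.
have [/andP[xP _] /andP[yN _]] := (uP, uN); split; last first.
  have f' : free (p x :: p y :: map p (Z ++ P ++ N)).
    rewrite -map_cons -map_cons.
    rewrite (perm_free (perm_map _ (_ : perm_eq _ (Z ++ (x :: P) ++ y :: N)))) //.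
    have := permEl (perm_catCA [:: x; y] Z (P ++ N)).
    move=> /perm_trans -> //; rewrite perm_cat2l /= perm_cons.
    exact: permEl (perm_catCA [:: y] P N).
  move: f'; rewrite !free_cons span_cons pxy => /and3P[px py ->]; rewrite andbT.
  by apply: contra px => h; rewrite -(addrK (p y) (p x)) addrC memv_add // memvN memv_line.
have [fZ oP oN oPN] := fr.
have Zz z w : z \in map p Z -> w \in map p Z ++ map p (x :: P) ++ map p (y :: N) -> B z w = 0.
  exact: fZ.
have [px py] : p x \in map p (x :: P) /\ p y \in map p (y :: N) by rewrite !mem_head.
have nul w : w \in map p Z ++ map p P ++ map p N -> B (p x + p y) w = 0.
  rewrite sformDl !mem_cat => /or3P[wZ|wP|wN].
  - by rewrite !(sformC B _ w) !fZ ?addr0 // !mem_cat ?px ?py ?orbT.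
  - rewrite oP ?inE ?wP ?orbT // (sformC B (p y)) oPN // ?inE ?wP ?orbT //.
    by rewrite (negbTE (memPnC xP w wP)) mulr0 addr0.
  rewrite oPN ?inE ?wN ?orbT // oN ?inE ?wN ?orbT //.
  by rewrite (negbTE (memPnC yN w wN)) mulr0 addr0.
have xyxy : B (p x + p y) (p x + p y) = 0.
  rewrite sformDl !sformDr (sformC B (p y) (p x)) (oP _ _ px px) (oN _ _ py py).
  by rewrite (oPN _ _ px py) !eqxx; ring.
split=> [z w|z w zP wP|z w zN wN|z w zP wN].
- rewrite /= !inE pxy => /predU1P[->|zZ] /predU1P[->|wA] //; first exact: nul.
    by rewrite sformC nul // mem_cat zZ.
  by apply: fZ => //; move: wA; rewrite !mem_cat !inE => /or3P[] ->; rewrite /= ?orbT.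
- by apply: oP; rewrite inE ?zP ?wP orbT.
- by apply: oN; rewrite inE ?zN ?wN orbT.
- by apply: oPN; rewrite inE ?zP ?wN orbT.
Qed.

Lemma half_frame_le p e Z P N Z' P' N' : e * e = 1 ->
    half_frame p e Z P N -> half_frame p e Z' P' N' ->
    (<<map p (Z' ++ P' ++ N')>> <= <<map p (Z ++ P ++ N)>>)%VS ->
  [/\ (size Z' + size P' <= size Z + size P)%N, (size P' <= size P)%N,
      (size Z' + size N' <= size Z + size N)%N & (size N' <= size N)%N].
Proof.
move=> e1 [fr f] [fr' f'] sub; rewrite !map_cat in f f' sub.
have [] := frame_le e1 fr fr' f f' sub; rewrite !size_map => -> ->.
have [||||] := frame_le _ (signed_frameC fr) (signed_frameC fr').
- by rewrite mulrNN.
- by rewrite (perm_free (perm_cat_tail _ _ _)).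
- by rewrite (perm_free (perm_cat_tail _ _ _)).
- rewrite (eq_span (perm_mem (perm_cat_tail (map p Z') _ _))).
  by rewrite (eq_span (perm_mem (perm_cat_tail (map p Z) _ _))).
by rewrite !size_map => -> ->.
Qed.

Lemma half_witt U p e Z P N Z' P' N' : radical B U = 0%VS ->
    (forall x, p x \in U) ->
    half_frame p e Z P N -> half_frame p e Z' P' N' ->
    size Z = size Z' -> size P = size P' -> size N = size N' ->
  exists2 g, isometry_group B U g &
    {in zip (Z ++ P ++ N) (Z' ++ P' ++ N'), forall z, g (p z.1) = p z.2}.
Proof.
move=> U0 pU [fr f] [fr' f'] sZ sP sN.
have szs : size (Z ++ P ++ N) = size (Z' ++ P' ++ N') by rewrite !size_cat sZ sP sN.
have sub (s : seq V) : {subset map p s <= U} by move=> _ /mapP[x _ ->].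
have [|||||g gU gz] := @witt_extension _ _ B U
  (zip (map p (Z ++ P ++ N)) (map p (Z' ++ P' ++ N'))) U0.
- by rewrite unzip1_zip ?size_map ?szs.
- by rewrite unzip2_zip ?size_map ?szs.
- by rewrite unzip1_zip ?size_map ?szs.
- by rewrite unzip2_zip ?size_map ?szs.
- rewrite !map_cat; have := f; have := f'; rewrite !map_cat => u' u.
  have [uP uP'] := (free_uniq (catl_free (catr_free u)), free_uniq (catl_free (catr_free u'))).
  have [uN uN'] := (free_uniq (catr_free (catr_free u)), free_uniq (catr_free (catr_free u'))).
  by apply: (signed_frame_gram fr fr'); rewrite ?size_map.
by exists g => // z zz; apply: (gz (p z.1, p z.2)); apply: mem_zip_map.
Qed.
End HalfFrames.

(** * Frames adapted to U and W *)

Section AdaptedFrames.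
Variables (R : realType) (V : vectType R) (B : {symmetric V}).
Implicit Types (e : R) (g : 'End(V)) (U W S T : {vspace V}) (x y : V).
Implicit Types (A C E P N L : seq V).

Definition orth_decomp U W :=
  [/\ (U + W)%VS = fullv, (U :&: W)%VS = 0%VS & (U <= orthov B W)%VS].

Lemma orth_decompC U W : orth_decomp U W -> orth_decomp W U.
Proof. by case=> UW UW0 oUW; split; rewrite 1?addvC 1?capvC // orthov_sym. Qed.

Lemma pi_add U W x : orth_decomp U W -> daddv_pi U W x + daddv_pi W U x = x.
Proof. by case=> UW UW0 _; rewrite daddv_pi_add // UW memvf. Qed.

Lemma pi_id U W x : orth_decomp U W -> x \in U -> daddv_pi U W x = x.
Proof. by case=> _ UW0 _; apply: daddv_pi_id. Qed.

Lemma pi_ker U W x : orth_decomp U W -> x \in W -> daddv_pi U W x = 0.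
Proof.
move=> d xW; apply: (addIr (daddv_pi W U x)).
by rewrite pi_add // add0r pi_id //; apply: orth_decompC.
Qed.

Lemma lker_pi U W : orth_decomp U W -> lker (daddv_pi U W) = W.
Proof.
move=> d; apply/vspaceP => x; rewrite memv_ker; apply/eqP/idP => [x0|]; last exact: pi_ker.
by rewrite -(pi_add x d) x0 add0r memv_pi.
Qed.

Lemma proj_subE U W S : orth_decomp U W -> proj_sub U W S = (daddv_pi U W @: S)%VS.
Proof.
move=> d; apply/vspaceP => x; rewrite memv_cap; apply/andP/memv_imgP.
  case=> /memv_addP[s sS [w wW ->]] swU; exists s => //.
  by rewrite -[LHS](pi_id d) // linearD /= (pi_ker d wW) addr0.
case=> s sS ->; rewrite memv_pi; split=> //.
rewrite -[daddv_pi U W s](addrK (daddv_pi W U s)) pi_add // memv_add // memvN.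
exact: memv_pi.
Qed.

Lemma form_pi U W x y : orth_decomp U W ->
  B x y = B (daddv_pi U W x) (daddv_pi U W y) + B (daddv_pi W U x) (daddv_pi W U y).
Proof.
move=> d; have [_ _ /orthovP oUW] := d.
rewrite -{1}(pi_add x d) -{1}(pi_add y d) sformDl !sformDr.
rewrite (oUW (daddv_pi U W x) (daddv_pi W U y)) ?memv_pi // addr0.
rewrite (sformC B (daddv_pi W U x) (daddv_pi U W y)).
by rewrite (oUW (daddv_pi U W y) (daddv_pi W U x)) ?memv_pi // add0r.
Qed.

Lemma radical_summand U W : orth_decomp U W -> nondegenerate B -> radical B U = 0%VS.
Proof.
move=> d /eqP nd; have [_ _ /orthovP oUW] := d.
apply/eqP; rewrite -subv0 -nd; apply/subvP => x; rewrite memv_cap => /andP[xU /mem_orthovP xo].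
apply/mem_orthovP => y _; rewrite (form_pi _ _ d) (pi_id d xU) xo ?memv_pi //.
by rewrite (pi_ker (orth_decompC d) xU) linear0l addr0.
Qed.

(* For isotropic vectors the forms induced by the two projections are opposite,
   hence the signs e and - e. *)
Definition adapted_frame e U W A C E P N :=
  [/\ {subset A <= U}, {subset C <= W},
      half_frame B (daddv_pi U W) e (A ++ E) P N &
      half_frame B (daddv_pi W U) (- e) (C ++ E) P N].

Lemma adapted_frameC e U W A C E P N :
  adapted_frame e U W A C E P N -> adapted_frame (- e) W U C A E P N.
Proof. by case=> AU CW fU fW; split; rewrite ?opprK. Qed.

Lemma adapted_frame_proj e U W A C E P N : orth_decomp U W ->
    adapted_frame e U W A C E P N ->
  (daddv_pi U W @: <<A ++ C ++ E ++ P ++ N>>)%VS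
    = <<map (daddv_pi U W) ((A ++ E) ++ P ++ N)>>%VS.
Proof.
move=> d [_ CW _ _]; rewrite -limg_span !span_cat !limgD.
suff -> : (daddv_pi U W @: <<C>>)%VS = 0%VS by rewrite add0v addvA.
by apply/eqP; rewrite -lkerE lker_pi //; apply/span_subvP.
Qed.

(** Rank-nullity for the projection to [W]: its kernel is [U], and its image has as basis the
    projections of all frame vectors except those of [A]. *)
Lemma adapted_frame_cap_dim e U W A C E P N : orth_decomp U W ->
    adapted_frame e U W A C E P N ->
  (\dim (<<A ++ C ++ E ++ P ++ N>> :&: U) <= size A)%N.
Proof.
move=> d fr; have [_ _ _ [_ fW]] := fr.
have imgW : (daddv_pi W U @: <<A ++ C ++ E ++ P ++ N>>)%VS
    = <<map (daddv_pi W U) ((C ++ E) ++ P ++ N)>>%VS.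
  rewrite -(adapted_frame_proj (orth_decompC d) (adapted_frameC fr)).
  by congr (_ @: _)%VS; rewrite !span_cat !addvA (addvC <<A>>%VS).
have := limg_ker_dim (daddv_pi W U) <<A ++ C ++ E ++ P ++ N>>.
rewrite (lker_pi (orth_decompC d)) imgW (eqnP fW) size_map => dT.
have := dim_span (A ++ C ++ E ++ P ++ N).
by rewrite -dT !size_cat -!addnA leq_add2r.
Qed.

(** The first bound holds because [A'] is free in the intersection of the larger span with [U]; the
    others compare the projections to [U]. *)
Lemma adapted_frame_le e U W A C E P N A' C' E' P' N' :
    e * e = 1 -> orth_decomp U W ->
    adapted_frame e U W A C E P N -> adapted_frame e U W A' C' E' P' N' ->
    (<<A' ++ C' ++ E' ++ P' ++ N'>> <= <<A ++ C ++ E ++ P ++ N>>)%VS ->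
  [/\ (size A' <= size A)%N,
      (size A' + size E' + size P' <= size A + size E + size P)%N, (size P' <= size P)%N,
      (size A' + size E' + size N' <= size A + size E + size N)%N & (size N' <= size N)%N].
Proof.
move=> e1 d fr fr' sub; have [AU CW fU fW] := fr; have [AU' CW' fU' fW'] := fr'.
have [|] := half_frame_le e1 fU fU'.
  by rewrite -(adapted_frame_proj d fr) -(adapted_frame_proj d fr') limgS.
rewrite !size_cat => -> -> -> ->; split=> //.
apply: leq_trans (adapted_frame_cap_dim d fr).
have idA' : map (daddv_pi U W) A' = A'.
  by rewrite -[RHS]map_id; apply/eq_in_map => x /AU'; apply: pi_id.
have fA' : free A'.
  by have [_] := fU'; rewrite !map_cat -!catA idA' => /catl_free.
rewrite -(eqnP fA') dimvS // subv_cap; apply/andP; split; last exact/span_subvP.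
by apply: subv_trans sub; rewrite span_cat addvSl.
Qed.

Lemma adapted_frame_img e U W A C E P N g : orth_decomp U W ->
    isometry_group_prod B U W g -> adapted_frame e U W A C E P N ->
  adapted_frame e U W (map g A) (map g C) (map g E) (map g P) (map g N).
Proof.
move=> d hg; have [UW _ oUW] := d; have [_ gB] := isometry_group_prod_sub UW oUW hg.
have [[gU _] [gW _]] := hg.
(* The image of [g] contains both summands, so [g] is onto, hence injective. *)
have g0 : lker g == 0%VS.
  rewrite -dimv_eq0 -(eqn_add2r (\dim (g @: fullv)%VS)) add0n -{1}(capfv (lker g)).
  by rewrite limg_ker_dim -UW limgD gU gW.
have gi : injective g by apply/lker0P.
have memg X v : (g @: X)%VS = X -> v \in X -> g v \in X.
  by move=> gX vX; rewrite -gX memv_img.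
have half T T' f Z P' N' : orth_decomp T T' -> (g @: T)%VS = T -> (g @: T')%VS = T' ->
    half_frame B (daddv_pi T T') f Z P' N' ->
    half_frame B (daddv_pi T T') f (map g Z) (map g P') (map g N').
  move=> dT gT gT' [[fZ oP oN oPN] fr].
  (* Preserving both summands, [g] commutes with the projections. *)
  have mapg (s : seq V) : map (daddv_pi T T') (map g s) = map g (map (daddv_pi T T') s).
    rewrite -!map_comp; apply: eq_map => x /=.
    rewrite -{1}(pi_add x dT) !linearD /= (pi_id dT (memg _ _ gT (memv_pi _ _ _))).
    by rewrite (pi_ker dT (memg _ _ gT' (memv_pi _ _ _))) addr0.
  have BE x y : B (g x) (g y) = B x y by apply: gB; apply: memvf.
  split.
    rewrite !mapg; split=> [x y|x y|x y|x y].
    - rewrite -!map_cat => /mapP[z zZ ->] /mapP[t tZ ->]; rewrite BE.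
      by apply: fZ; rewrite // -!map_cat.
    - by move=> /mapP[z zZ ->] /mapP[t tZ ->]; rewrite BE (inj_eq gi) oP.
    - by move=> /mapP[z zZ ->] /mapP[t tZ ->]; rewrite BE (inj_eq gi) oN.
    - by move=> /mapP[z zZ ->] /mapP[t tZ ->]; rewrite BE oPN.
  rewrite -!map_cat mapg /free -limg_span limg_dim_eq ?(eqP g0) ?capv0 //.
  by rewrite (eqnP fr) !size_map.
case=> AU CW fU fW; split.
- by move=> _ /mapP[x /AU xU ->]; rewrite -gU memv_img.
- by move=> _ /mapP[x /CW xU ->]; rewrite -gW memv_img.
- by rewrite -map_cat; apply: half.
- by rewrite -map_cat; apply: half => //; apply: orth_decompC.
Qed.
End AdaptedFrames.

(** * From the invariants of an isotropic subspace to an adapted frame *)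

Section OrbitInvariants.
Variables (R : realType) (V : vectType R) (B : {symmetric V}).
Implicit Types (g : 'End(V)) (U W S : {vspace V}) (x y : V).
Implicit Types (A C E P N L : seq V).

Lemma lift_map (f : 'End(V)) S L : {subset L <= (f @: S)%VS} ->
  exists2 L' : seq V, {subset L' <= S} & map f L' = L.
Proof.
elim: L => [|x L IH] sL; first by exists [::].
have [|L' L'S <-] := IH; first by move=> y yL; apply: sL; rewrite inE yL orbT.
have /memv_imgP[s sS ->] := sL x (mem_head _ _).
by exists (s :: L') => // y; rewrite inE => /predU1P[->|/L'S].
Qed.

(** A basis [A] of the part of [S] in [U] is completed first to the radical of the projection to
    [U], then to a frame of that projection; the added vectors are lifted to [S]. Isotropy carries
    the relations over to [W]. *)
Lemma adapted_frame_exists U W S rU rW a bU bW : orth_decomp B U W ->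
    isotropic B S -> has_invariants B U W S rU rW a bU bW ->
  exists A C E P N, [/\ adapted_frame B 1 U W A C E P N,
    [/\ size A = rU, size C = rW, size E = a, size P = bU & size N = bW] &
    <<A ++ C ++ E ++ P ++ N>>%VS = S].
Proof.
move=> d isoS [-> -> -> [Yp [YpX pYp mYp] <-] [Yn [YnX pYn mYn] <-]].
have dC := orth_decompC d; have [_ _ oUW] := d.
pose pU := daddv_pi U W; pose pW := daddv_pi W U.
set X := proj_sub U W S in YpX mYp YnX mYn *.
have XE : X = (pU @: S)%VS by exact: proj_subE d.
have SUX : (S :&: U <= radical B X)%VS by exact: (capv_sub_radical_proj oUW isoS).
pose A : seq V := vbasis (S :&: U)%VS.
pose EX : seq V := vbasis (radical B X :\: (S :&: U))%VS.
have bAE : basis_of (radical B X) (A ++ EX).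
  have defr : (S :&: U + (radical B X :\: (S :&: U)))%VS = radical B X.
    by have := addv_diff_cap (radical B X) (S :&: U)%VS; rewrite (capv_idPr SUX) addvC.
  rewrite -{1}defr; apply: cat_basis; try exact: vbasisP.
  by apply/directv_addP; rewrite capvC capv_diff.
have [PX [NX [frX bX]]] := frame_exists bAE.
have inX L : {subset L <= (A ++ EX) ++ PX ++ NX} -> {subset L <= (pU @: S)%VS}.
  by move=> sL x /sL /(basis_mem bX); rewrite XE.
have [|E ES EE] := @lift_map pU S EX.
  by apply: inX => x xL; rewrite !mem_cat xL orbT.
have [|P PS PE] := @lift_map pU S PX.
  by apply: inX => x xL; rewrite !mem_cat xL !orbT.
have [|N NS NE] := @lift_map pU S NX.
  by apply: inX => x xL; rewrite !mem_cat xL !orbT.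
have AS : {subset A <= S} by move=> x /vbasis_mem; rewrite memv_cap => /andP[].
have AU : {subset A <= U} by move=> x /vbasis_mem; rewrite memv_cap => /andP[].
have AE : map pU A = A.
  by rewrite -[RHS]map_id; apply/eq_in_map => x /AU; apply: (pi_id d).
pose C : seq V := vbasis (S :&: W)%VS.
have CS : {subset C <= S} by move=> x /vbasis_mem; rewrite memv_cap => /andP[].
have CW : {subset C <= W} by move=> x /vbasis_mem; rewrite memv_cap => /andP[].
have fU : half_frame B pU 1 (A ++ E) P N.
  by split; rewrite !map_cat AE EE PE NE //; apply: basis_free bX.
have sA : size A = \dim (S :&: U) by rewrite size_tuple.
have sC : size C = \dim (S :&: W) by rewrite size_tuple.
have sE : size E = inv_a B U W S.
  have -> : size E = size EX by rewrite -EE size_map.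
  rewrite size_tuple /inv_a -/X.
  by rewrite -(dimv_cap_compl (radical B X) (S :&: U)) (capv_idPr SUX) addKn.
have e1 : 1 * 1 = 1 :> R by rewrite mulr1.
have eN : - 1 * - 1 = 1 :> R by rewrite mulrNN mulr1.
have sP : size P = \dim Yp.
  have -> : size P = size PX by rewrite -PE size_map.
  apply/esym/(frame_index e1 frX bX YpX) => [x xY x0|D DX pD]; first by rewrite mul1r pYp.
  by apply: mYp => // x xD x0; have := pD x xD x0; rewrite mul1r.
have sN : size N = \dim Yn.
  have -> : size N = size NX by rewrite -NE size_map.
  have bX' : basis_of X ((A ++ EX) ++ NX ++ PX).
    by rewrite (perm_basis _ (perm_cat_tail _ _ _)).
  apply/esym/(frame_index eN (signed_frameC frX) bX' YnX) => [x xY x0|D DX pD].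
    by rewrite mulN1r oppr_gt0 pYn.
  by apply: mYn => // x xD x0; have := pD x xD x0; rewrite mulN1r oppr_gt0.
have spanS : <<A ++ C ++ E ++ P ++ N>>%VS = S.
  apply/eqP; rewrite eqEsubv; apply/andP; split.
    apply/span_subvP => x; rewrite !mem_cat.
    by case/or4P=> [/AS|/CS|/ES|/orP[/PS|/NS]].
  apply/subvP => s sS.
  have : pU s \in <<map pU ((A ++ E) ++ P ++ N)>>%VS.
    by rewrite !map_cat AE EE PE NE (span_basis bX) XE memv_img.
  rewrite -limg_span => /memv_imgP[t tT st].
  have sub L : {subset L <= A ++ C ++ E ++ P ++ N} -> (<<L>> <= <<A ++ C ++ E ++ P ++ N>>)%VS.
    exact: sub_span.
  have tS : t \in <<A ++ C ++ E ++ P ++ N>>%VS.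
    apply: subvP tT; apply: sub => x; rewrite !mem_cat.
    by case/orP=> [/orP[]|/orP[]] ->; rewrite ?orbT.
  have ltS : t \in S.
    apply: subvP tT; apply/span_subvP => x; rewrite !mem_cat.
    by case/orP=> [/orP[/AS|/ES]|/orP[/PS|/NS]].
  rewrite -(subrK t s) memvD //.
  (* [s] and its lift [t] have the same projection to [U], so they differ by an element of [S] in
     [W]. *)
  have : s - t \in <<C>>%VS.
    rewrite (span_basis (vbasisP _)) memv_cap memvB //= -(lker_pi d) memv_ker.
    by rewrite linearB /= subr_eq0; apply/eqP.
  by apply: subvP; apply: sub => x xC; rewrite !mem_cat xC orbT.
have fW : half_frame B pW (- 1) (C ++ E) P N.
  have memS x : x \in (C ++ E) ++ P ++ N -> x \in S.
    by rewrite !mem_cat; case/orP=> [/orP[/CS|/ES]|/orP[/PS|/NS]].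
  (* On an isotropic subspace the contributions of the two projections to [B x y] cancel. *)
  have BW x y : x \in S -> y \in S -> B (pW x) (pW y) = - B (pU x) (pU y).
    move=> xS yS; have := orthovP isoS x y xS yS.
    by rewrite (form_pi x y d) addrC => /eqP; rewrite addr_eq0 => /eqP.
  have imgW : <<map pW ((C ++ E) ++ P ++ N)>>%VS = (pW @: S)%VS.
    rewrite -limg_span -spanS !span_cat !limgD.
    suff -> : (pW @: <<A>>)%VS = 0%VS by rewrite add0v -addvA.
    by apply/eqP; rewrite -lkerE (lker_pi dC); apply/span_subvP.
  (* Rank-nullity for [pU] and for [pW] computes [\dim S] twice; comparing gives the image under
     [pW] the dimension required for freeness. *)
  have free_pW : free (map pW ((C ++ E) ++ P ++ N)).
    have dimX : \dim (pU @: S)%VS = size ((A ++ E) ++ P ++ N).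
      rewrite -XE -(span_basis bX) (eqnP (basis_free bX)).
      by rewrite -PE -NE -EE !size_cat !size_map.
    have dW := limg_ker_dim pW S; have dU := limg_ker_dim pU S.
    rewrite (lker_pi d) dimX -sC in dU; rewrite (lker_pi dC) -sA in dW.
    rewrite /free imgW size_map -(eqn_add2l (size A)) dW -dU !size_cat.
    by apply/eqP; ring.
  (* The deltas in a frame compare projected vectors; injectivity on the lists turns equality under
     [pU] into equality under [pW]. *)
  have injm (f : 'End(V)) x y L :
      free (map f L) -> x \in L -> y \in L -> (f x == f y) = (x == y).
    move=> /free_uniq/uniq_map_inj fL xL yL; apply/eqP/eqP => [|-> //]; exact: fL.
  have [[fZ oP oN oPN]] := fU; rewrite !map_cat -!catA.
  move=> /catr_free/catr_free/[dup]/catl_free fPU /catr_free fNU.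
  have := free_pW; rewrite !map_cat -!catA.
  move=> /catr_free/catr_free/[dup]/catl_free fPW /catr_free fNW.
  split; last exact: free_pW.
  split.
  - move=> _ y /mapP[x xZ ->]; rewrite -!map_cat => /mapP[{}y yA ->].
    rewrite BW ?memS //; last by rewrite mem_cat xZ.
    have [xC|xE] : x \in C \/ x \in E by apply/orP; rewrite -mem_cat.
      by rewrite (pi_ker d (CW _ xC)) linear0l oppr0.
    have [yC|yE] : y \in C \/ y \in E ++ P ++ N.
      by apply/orP; rewrite -mem_cat; move: yA; rewrite -catA.
      by rewrite (pi_ker d (CW _ yC)) linear0r oppr0.
    rewrite fZ ?oppr0 //; first by rewrite map_f // mem_cat xE orbT.
    by rewrite -!map_cat; apply: map_f; rewrite -catA mem_cat yE orbT.
  - move=> _ _ /mapP[x xP ->] /mapP[y yP ->].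
    rewrite BW ?memS ?mem_cat ?xP ?yP ?orbT // oP ?map_f //.
    by rewrite (injm pU _ _ P) // (injm pW _ _ P) // mulNr.
  - move=> _ _ /mapP[x xP ->] /mapP[y yP ->].
    rewrite BW ?memS ?mem_cat ?xP ?yP ?orbT // oN ?map_f //.
    by rewrite (injm pU _ _ N) // (injm pW _ _ N) // [RHS]mulNr.
  - move=> _ _ /mapP[x xP ->] /mapP[y yP ->].
    by rewrite BW ?memS ?mem_cat ?xP ?yP ?orbT // oPN ?map_f // oppr0.
by exists A, C, E, P, N.
Qed.
End OrbitInvariants.

(** * Shrinking frames and matching them by isometries *)

Section Containment.
Variables (R : realType) (V : vectType R) (B : {symmetric V}).
Implicit Types (e : R) (g : 'End(V)) (U W S : {vspace V}) (x y : V).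
Implicit Types (A C E P N : seq V).

Lemma adapted_frame_subseq e U W A C E P N A' C' E' P' N' :
    subseq A' A -> subseq C' C -> subseq E' E -> subseq P' P -> subseq N' N ->
  adapted_frame B e U W A C E P N -> adapted_frame B e U W A' C' E' P' N'.
Proof.
move=> sA sC sE sP sN [AU CW fU fW]; split.
- by move=> x /(mem_subseq sA)/AU.
- by move=> x /(mem_subseq sC)/CW.
- by apply: half_frame_subseq fU => //; apply: cat_subseq.
- by apply: half_frame_subseq fW => //; apply: cat_subseq.
Qed.

(** The sum [x + y] projects to [x] in [U] and to [y] in [W], so it takes the place of [x] in one
    half frame and of [y] in the other. *)
Lemma adapted_frame_null e U W A C E P N x y : orth_decomp B U W ->
  adapted_frame B e U W (x :: A) (y :: C) E P N ->
  adapted_frame B e U W A C (x + y :: E) P N.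
Proof.
move=> d [AU CW fU fW].
have xU : x \in U by apply: AU; apply: mem_head.
have yW : y \in W by apply: CW; apply: mem_head.
split.
- by move=> z zA; apply: AU; rewrite inE zA orbT.
- by move=> z zC; apply: CW; rewrite inE zC orbT.
- apply: half_frame_perm fU; rewrite !map_cat !map_cons linearD /= (pi_ker d yW) addr0.
  exact: permEl (perm_catCA [:: _] _ _).
- apply: half_frame_perm fW; rewrite !map_cat !map_cons linearD /=.
  rewrite (pi_ker (orth_decompC d) xU) add0r.
  exact: permEl (perm_catCA [:: _] _ _).
Qed.

Lemma adapted_frame_hyperbolic e U W A C E P N x y :
  adapted_frame B e U W A C E (x :: P) (y :: N) ->
  adapted_frame B e U W A C (x + y :: E) P N.
Proof.
case=> AU CW fU fW; split=> //.
- apply: half_frame_perm (half_frame_hyperbolic fU); apply: perm_map.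
  exact: permEl (perm_catCA [:: _] _ _).
- apply: half_frame_perm (half_frame_hyperbolic fW); apply: perm_map.
  exact: permEl (perm_catCA [:: _] _ _).
Qed.

(** Induction on the deficit [a - size E]. Each trade lengthens [E] by one and leaves the four sums
    of three sizes unchanged; with no deficit left, the lists are truncated. *)
Lemma adapted_frame_shrink e U W A C E P N (rU rW a bU bW : nat) :
    orth_decomp B U W -> adapted_frame B e U W A C E P N ->
    (rU <= size A)%N -> (rW <= size C)%N -> (bU <= size P)%N -> (bW <= size N)%N ->
    (rU + a + bU <= size A + size E + size P)%N ->
    (rU + a + bW <= size A + size E + size N)%N ->
    (rW + a + bU <= size C + size E + size P)%N ->
    (rW + a + bW <= size C + size E + size N)%N ->
  exists A' C' E' P' N', [/\ adapted_frame B e U W A' C' E' P' N',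
    [/\ size A' = rU, size C' = rW, size E' = a, size P' = bU & size N' = bW] &
    (<<A' ++ C' ++ E' ++ P' ++ N'>> <= <<A ++ C ++ E ++ P ++ N>>)%VS].
Proof.
move=> d; move: {-1}(a - size E)%N (erefl (a - size E)%N) => n.
elim: n A C E P N => [|n IH] A C E P N dn fr lA lC lP lN l1 l2 l3 l4.
  have lE : (a <= size E)%N by rewrite -subn_eq0 dn.
  exists (take rU A), (take rW C), (take a E), (take bU P), (take bW N).
  split; last by apply: sub_span; apply: mem_subseq; rewrite !cat_subseq // take_subseq.
    by apply: adapted_frame_subseq fr; apply: take_subseq.
  by rewrite !size_takel.
(* If one of [A], [C] and one of [P], [N] had no surplus, the matching inequality among the four
   would give [a <= size E]. *)
have [/andP[ltA ltC]|/andP[ltP ltN]] :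
    (rU < size A)%N && (rW < size C)%N \/ (bU < size P)%N && (bW < size N)%N by lia.
  case: A C ltA ltC fr lA lC l1 l2 l3 l4 => [|x A] [|y C] //= ltA ltC fr lA lC l1 l2 l3 l4.
  have [//|||||||||A' [C' [E' [P' [N' [fr' sz sub]]]]]] :=
    IH A C (x + y :: E) P N _ (adapted_frame_null d fr); try (rewrite /=; lia).
  exists A', C', E', P', N'; split=> //; apply: subv_trans sub _.
  apply/span_subvP => z; rewrite !mem_cat inE => zL.
  have [->|zxy] := eqVneq z (x + y).
    by apply: memvD; apply: memv_span; rewrite !(inE, mem_cat) eqxx ?orbT.
  apply: memv_span; move: zL; rewrite (negbTE zxy) /= !(inE, mem_cat).
  by case/or4P=> [||| /orP[]] ->; rewrite /= ?orbT.
case: P N ltP ltN fr lP lN l1 l2 l3 l4 => [|x P] [|y N] //= ltP ltN fr lP lN l1 l2 l3 l4.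
have [//|||||||||A' [C' [E' [P' [N' [fr' sz sub]]]]]] :=
  IH A C (x + y :: E) P N _ (adapted_frame_hyperbolic fr); try (rewrite /=; lia).
exists A', C', E', P', N'; split=> //; apply: subv_trans sub _.
apply/span_subvP => z; rewrite !mem_cat inE => zL.
have [->|zxy] := eqVneq z (x + y).
  by apply: memvD; apply: memv_span; rewrite !(inE, mem_cat) eqxx ?orbT.
apply: memv_span; move: zL; rewrite (negbTE zxy) /= !(inE, mem_cat).
by case/or4P=> [||| /orP[]] ->; rewrite /= ?orbT.
Qed.

(** Witt's theorem is applied separately to the two half frames. A vector of [E], [P] or [N] has
    both projections sent to those of the same partner, so the glued map sends it to that
    partner. *)
Lemma witt_containment e U W A C E P N A' C' E' P' N' :
    nondegenerate B -> orth_decomp B U W ->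
    adapted_frame B e U W A C E P N -> adapted_frame B e U W A' C' E' P' N' ->
    size A = size A' -> size C = size C' -> size E = size E' ->
    size P = size P' -> size N = size N' ->
  exists2 g, isometry_group_prod B U W g &
    (g @: <<A ++ C ++ E ++ P ++ N>> <= <<A' ++ C' ++ E' ++ P' ++ N'>>)%VS.
Proof.
move=> nd d [AU CW fU fW] [AU' CW' fU' fW'] sA sC sE sP sN; have dC := orth_decompC d.
have [||gU [gUU gUB] gUz] := half_witt (radical_summand d nd) _ fU fU' _ sP sN.
- by move=> x; apply: memv_pi.
- by rewrite !size_cat sA sE.
have [||gW [gWW gWB] gWz] := half_witt (radical_summand dC nd) _ fW fW' _ sP sN.
- by move=> x; apply: memv_pi.
- by rewrite !size_cat sC sE.
pose g : 'End(V) := (gU \o daddv_pi U W)%VF + (gW \o daddv_pi W U)%VF.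
have gE x : g x = gU (daddv_pi U W x) + gW (daddv_pi W U x).
  by rewrite /g add_lfunE !comp_lfunE.
have gonU x : x \in U -> g x = gU x.
  by move=> xU; rewrite gE (pi_id d xU) (pi_ker dC xU) linear0 addr0.
have gonW x : x \in W -> g x = gW x.
  by move=> xW; rewrite gE (pi_id dC xW) (pi_ker d xW) linear0 add0r.
have limgU : (g @: U)%VS = U by rewrite -{2}gUU; apply: eq_in_limg.
have limgW : (g @: W)%VS = W by rewrite -{2}gWW; apply: eq_in_limg.
exists g.
  split; split=> // x y xX yX; first by rewrite !gonU // gUB.
  by rewrite !gonW // gWB.
rewrite limg_span; apply/span_subvP => _ /mapP[x xL ->].
have zU : zip ((A ++ E) ++ P ++ N) ((A' ++ E') ++ P' ++ N')
    = zip A A' ++ zip E E' ++ zip P P' ++ zip N N'.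
  by rewrite !zip_cat ?size_cat ?sA ?sE // -catA.
have zW : zip ((C ++ E) ++ P ++ N) ((C' ++ E') ++ P' ++ N')
    = zip C C' ++ zip E E' ++ zip P P' ++ zip N N'.
  by rewrite !zip_cat ?size_cat ?sC ?sE // -catA.
have both s t : size s = size t ->
    {subset zip s t <= zip E E' ++ zip P P' ++ zip N N'} -> x \in s ->
    exists2 y, y \in t & g x = y.
  move=> st sub /(exists_mem_zip st)[y yt xy]; exists y => //.
  have xyL := sub _ xy; rewrite gE.
  have -> : gU (daddv_pi U W x) = daddv_pi U W y.
    by apply: (gUz (x, y)); rewrite zU mem_cat xyL orbT.
  have -> : gW (daddv_pi W U x) = daddv_pi W U y.
    by apply: (gWz (x, y)); rewrite zW mem_cat xyL orbT.
  exact: pi_add d.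
suff [y yL ->] : exists2 y, y \in A' ++ C' ++ E' ++ P' ++ N' & g x = y by apply: memv_span.
move: xL; rewrite !mem_cat => /or4P[xA|xC|xE|/orP[xP|xN]].
- have [y yA xy] := exists_mem_zip sA xA; exists y; first by rewrite mem_cat yA.
  rewrite (gonU _ (AU _ xA)).
  have := gUz (x, y); rewrite zU mem_cat xy => /(_ isT) /=.
  by rewrite (pi_id d (AU _ xA)) (pi_id d (AU' _ yA)).
- have [y yC xy] := exists_mem_zip sC xC; exists y; first by rewrite !mem_cat yC orbT.
  rewrite (gonW _ (CW _ xC)).
  have := gWz (x, y); rewrite zW mem_cat xy => /(_ isT) /=.
  by rewrite (pi_id dC (CW _ xC)) (pi_id dC (CW' _ yC)).
- have [|y yE ->] := both _ _ sE _ xE; first by move=> z zz; rewrite mem_cat zz.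
  by exists y; rewrite // !mem_cat yE ?orbT.
- have [|y yP ->] := both _ _ sP _ xP; first by move=> z zz; rewrite !mem_cat zz orbT.
  by exists y; rewrite // !mem_cat yP ?orbT.
- have [|y yN ->] := both _ _ sN _ xN; first by move=> z zz; rewrite !mem_cat zz !orbT.
  by exists y; rewrite // !mem_cat yN ?orbT.
Qed.
End Containment.

Theorem theorem5p6 (R : realType) (p q p1 q1 : nat)
    (hp : (0 < p1 < p)%N) (hq : (0 < q1 < q)%N)
    (B : {symmetric 'rV[R]_(p + q)}) (U W : {vspace 'rV[R]_(p + q)})
    (ndB : nondegenerate B) (sigB : has_signature B fullv p q)
    (addUW : (U + W)%VS = fullv) (capUW : (U :&: W)%VS = 0%VS)
    (orthUW : (U <= orthov B W)%VS)
    (sigU : has_signature B U p1 q1)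
    (sigW : has_signature B W (p - p1) (q - q1))
    (rU rW a bU bW rU' rW' a' bU' bW' : nat)
    (O O' : set {vspace 'rV[R]_(p + q)})
    (hO : is_isotropic_orbit B U W rU rW a bU bW O)
    (hO' : is_isotropic_orbit B U W rU' rW' a' bU' bW' O') :
  (exists S S' : {vspace 'rV[R]_(p + q)}, [/\ O S, O' S' & (S' <= S)%VS])
  <->
  [/\ [/\ (rU >= rU')%N, (rW >= rW')%N, (bU >= bU')%N & (bW >= bW')%N],
      (rU + a + bU >= rU' + a' + bU')%N,
      (rU + a + bW >= rU' + a' + bW')%N,
      (rW + a + bU >= rW' + a' + bU')%N
    & (rW + a + bW >= rW' + a' + bW')%N].
Proof.
have d : orth_decomp B U W by split.
have [S0 [iso inv ->]] := hO; have [S0' [iso' inv' ->]] := hO'.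
have [A [C [E [P [N [fr [<- <- <- <- <-] spanS]]]]]] := adapted_frame_exists d iso inv.
have [A' [C' [E' [P' [N' [fr' [<- <- <- <- <-] spanS']]]]]] :=
  adapted_frame_exists d iso' inv'.
split=> [[_ [_ [[g hg <-] [g' hg' <-] sub]]]|[[lA lC lP lN] l1 l2 l3 l4]].
  (* Arbitrary members of the orbits have as frames the images of two fixed frames, with the same
     sizes. *)
  have gfr := adapted_frame_img d hg fr; have gfr' := adapted_frame_img d hg' fr'.
  rewrite -spanS -spanS' !limg_span !map_cat in sub.
  have [|] := adapted_frame_le _ d gfr gfr' sub; first by rewrite mulr1.
  (* Exchanging [U] and [W] flips the sign of the frames but keeps [P] and [N] in place, which gives
     the bounds with [C] for [A]. *)
  have [||] := adapted_frame_le _ (orth_decompC d) (adapted_frameC gfr) (adapted_frameC gfr').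
  - by rewrite mulrNN mulr1.
  - move: sub; rewrite !span_cat !addvA.
    by rewrite (addvC <<map g' A'>>%VS) (addvC <<map g A>>%VS).
  by rewrite !size_map.
have [A1 [C1 [E1 [P1 [N1 [fr1 [sA sC sE sP sN] sub]]]]]] :=
  adapted_frame_shrink d fr lA lC lP lN l1 l2 l3 l4.
have [g hg gS] :=
  witt_containment ndB d fr' fr1 (esym sA) (esym sC) (esym sE) (esym sP) (esym sN).
(* [S0] is kept, and [S0'] is moved into the subspace spanned by the shrunken frame. *)
exists S0, (g @: S0')%VS; split.
- exists \1%VF; last by rewrite lim1g.
  by split; split=> [|x y _ _]; rewrite ?lim1g ?id_lfunE.
- by exists g.
by rewrite -spanS -spanS'; apply: subv_trans gS sub.
Qed.
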